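(* For any probability distribution $p$ on $[0,1]$ there exists a probability distribution $q$ on $[0,1]$ whose support contains at most one nonzero point, such that \[\mathbb E_q(X)=\mathbb E_p(X),\qquad \mathbb E_q(H(X))=\mathbb E_p(H(X)),\qquad \mathbb E_{q,q}(H(X_1X_2))\le \mathbb E_{p,p}(H(X_1X_2)).\]
   Context: $H(x)=-x\log x-(1-x)\log(1-x)$ for $x\in[0,1]$ is the binary entropy function, with $H(0)=H(1)=0$. For a distribution $r$ on $[0,1]$, $\mathbb E_r$ denotes expectation with $X\sim r$, and $\mathbb E_{r,r}(H(X_1X_2))$ denotes the expectation of $H(X_1X_2)$ where $X_1,X_2$ are independent, each with distribution $r$. *)

(* Defs.v *)
From HB Require Import structures.
From mathcomp Require Import all_boot all_order all_algebra.
From mathcomp Require Import all_classical all_reals all_analysis.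

Set Implicit Arguments.
Unset Strict Implicit.
Unset Printing Implicit Defensive.

Import Order.TTheory GRing.Theory Num.Theory.
Import numFieldNormedType.Exports.

Local Open Scope classical_set_scope.
Local Open Scope ring_scope.

(* [ln] takes the value 0 on nonpositive reals, so [entropy 0 = entropy 1 = 0].
   Only the values on [0, 1] matter. *)
Definition entropy (R : realType) (x : R) : R :=
  - x * ln x - (1 - x) * ln (1 - x).

(* Distributions on [0, 1] are encoded as Borel probabilities on R giving full
   mass to [0, 1]. *)
Definition on_unit_interval (R : realType)
    (P : probability (measurableTypeR R) R) : Prop :=
  P `[0, 1]%classic = 1%E.

Definition msupport (R : realType)
    (P : probability (measurableTypeR R) R) : set R :=
  [set x | forall U : set R, open U -> U x -> (0 < P U)%E].

Section entropy_sanity.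
Context {R : realType}.

Lemma entropy0 : entropy (0 : R) = 0.
Proof. by rewrite /entropy subr0 ln1 oppr0 mul0r mulr0 subrr. Qed.

Lemma entropy1 : entropy (1 : R) = 0.
Proof. by rewrite /entropy subrr ln1 mulr0 mul0r subrr. Qed.

End entropy_sanity.

(* Main.v *)
Require Import Defs.
From HB Require Import structures.
From mathcomp Require Import all_boot all_order all_algebra.
From mathcomp Require Import all_classical all_reals all_analysis.
From mathcomp Require Import measurable_realfun ring lra.

(* Write g x = - x ln x, m = E_p X and h = E_p (H X).

   For fixed y in [0, 1], H (y x) / x is a convex function of H x / x, because
   (H (y x) / x)' = ln (1 - y x) / x^2 and ln (1 - y x) / ln (1 - x) is
   nonincreasing in x.  Jensen's inequality for the size-biased law x p(dx) / m
   then shows that the law q on {0, x0} with the same m and h minimizes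
   E (H (X y)), simultaneously for all y; integrating over y,
   B (p, q) <= B (p, p), where B (p, q) is the expectation of H (X Y) for
   independent X ~ p and Y ~ q.

   On the other hand,
   H (x y) = x g y + y g x + x y - sum_(n >= 2) (x y)^n / (n (n - 1)),
   so B (p - q, p - q) <= 0 as soon as p and q have the same mean.  Hence
   B (q, q) <= 2 B (p, q) - B (p, p) <= B (p, p). *)

Set Implicit Arguments.
Unset Strict Implicit.
Unset Printing Implicit Defensive.

Import Order.TTheory GRing.Theory Num.Theory.
Import numFieldNormedType.Exports.

Local Open Scope classical_set_scope.
Local Open Scope ring_scope.

(** * Continuity of x ln x, and elementary facts on the binary entropy *)

Lemma continuous_xlnx (R : realType) : continuous (fun x : R => x * ln x).
Proof.
move=> x; have [x0|x0|->] := ltgtP x 0.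
(* To the left of 0, [ln] has its default value 0, so the function vanishes near x. *)
- apply: (@near_cst_continuous _ _ 0).
  near=> z; rewrite ln0 ?mulr0//; apply: ltW; near: z; exact: lt_nbhsl.
- apply: cvgM; [exact: cvg_id|exact: continuous_ln].
- rewrite /continuous_at /= mul0r.
  apply/norm_cvg0P.
  (* The majorant comes from ln u < u at u = 1 / sqrt z, together with ln z = 2 ln (sqrt z). *)
  apply: (@squeeze_cvgr _ _ _ _ (cst 0) (fun z : R => 2 * Num.sqrt `|z|)).
  + near=> z; rewrite normr_ge0/=.
    have [z0|z0] := leP z 0.
      by rewrite ln0// mulr0 normr0 mulr_ge0 ?sqrtr_ge0.
    rewrite (gtr0_norm z0).
    have z1 : z < 1 by near: z; exact: lt_nbhsl.
    have s0 : 0 < Num.sqrt z by rewrite sqrtr_gt0.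
    have := @ln_sublinear _ (Num.sqrt z)^-1; rewrite invr_gt0 => /(_ s0).
    rewrite lnV ?posrE// => h.
    have hz : ln z = 2 * ln (Num.sqrt z).
      by rewrite mulr_natl -lnXn// sqr_sqrtr// ltW.
    rewrite normrM gtr0_norm// ler0_norm ?ln_le0 ?(ltW z1)// hz.
    rewrite -{1}(@sqr_sqrtr _ z) ?(ltW z0)//.
    have : Num.sqrt z * (- ln (Num.sqrt z)) <= 1.
      by rewrite -(@mulfV _ (Num.sqrt z)) ?gt_eqF// ler_pM2l// ltW.
    nra.
  + exact: cvg_cst.
  + rewrite [X in _ --> X](_ : _ = 2 * Num.sqrt `|0 : R|); last first.
      by rewrite normr0 sqrtr0 mulr0.
    apply: cvgM; first exact: cvg_cst.
    apply: (continuous_comp (@norm_continuous _ R^o 0)); exact: sqrt_continuous.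
Unshelve. all: by end_near. Qed.

Section entropy_facts.
Context {R : realType}.
Implicit Types x y t : R.

Lemma is_derive_onem t : is_derive t (1 : R) (fun z : R => 1 - z) (-1).
Proof. by rewrite -[-1]sub0r; exact: is_deriveB. Qed.

Lemma is_derive_ln_onem t : t < 1 ->
  is_derive t (1 : R) (fun z : R => ln (1 - z)) (- (1 - t)^-1).
Proof.
move=> t1; have d1 := is_derive_onem t.
have d2 : is_derive (1 - t) (1 : R) (@ln R) (1 - t)^-1.
  by apply: is_derive1_ln; rewrite subr_gt0.
rewrite -mulrN1; exact: (@is_derive1_comp _ (@ln R) (fun z : R => 1 - z)).
Qed.

Lemma continuous_xlnx_onem : continuous (fun z : R => (1 - z) * ln (1 - z)).
Proof.
move=> x; apply: (@continuous_comp _ _ _ (fun z : R => 1 - z) (fun z => z * ln z)).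
  by apply: cvgB; [exact: cvg_cst|exact: cvg_id].
exact: continuous_xlnx.
Qed.

Lemma continuous_entropy : continuous (@entropy R).
Proof.
move=> x; rewrite /continuous_at.
have -> : @entropy R = (fun x => - (x * ln x) - (1 - x) * ln (1 - x)).
  by apply/funext => z; rewrite /entropy mulNr.
apply: cvgB; first by apply: cvgN; exact: continuous_xlnx.
exact: continuous_xlnx_onem.
Qed.

Lemma continuous_entropyM y : continuous (fun x => entropy (y * x)).
Proof.
move=> x; apply: (@continuous_comp _ _ _ (fun z : R => y * z) (@entropy R)).
  by apply: cvgM; [exact: cvg_cst|exact: cvg_id].
exact: continuous_entropy.
Qed.

Lemma entropy_ge0 x : 0 <= x <= 1 -> 0 <= entropy x.
Proof.
move=> /andP[x0 x1].
have : x * ln x <= 0 by rewrite mulr_ge0_le0// ln_le0.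
have : (1 - x) * ln (1 - x) <= 0.
  by rewrite mulr_ge0_le0 ?subr_ge0// ln_le0// gerBl.
rewrite /entropy; lra.
Qed.

(** Gibbs' inequality. The bound ln (1 + s) <= s gives u ln v - u ln u <= v - u; for the pairs (x,
    t) and (1 - x, 1 - t) the right-hand sides add up to 0. *)
Lemma entropy_gibbs x t : 0 <= x <= 1 -> 0 < t < 1 ->
  entropy x <= - (x * ln t) - (1 - x) * ln (1 - t).
Proof.
have key (u v : R) : 0 <= u -> 0 < v -> u * ln v - u * ln u <= v - u.
  rewrite le_eqVlt => /predU1P[<- v0|u0 v0]; first by rewrite !mul0r !subr0 ltW.
  rewrite -mulrBr -ln_div ?posrE// -ler_pdivlMl// mulrBr mulVf ?gt_eqF//.
  have := @le_ln1Dx _ (v / u - 1).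
  rewrite [1 + _](_ : _ = v / u); last by ring.
  rewrite (mulrC _ v); apply.
  by rewrite ltrBrDl subrr divr_gt0.
move=> /andP[x0 x1] /andP[t0 t1].
have := key _ _ x0 t0; have := key (1 - x) (1 - t).
rewrite subr_ge0 subr_gt0 => /(_ x1 t1).
rewrite /entropy; lra.
Qed.

Lemma is_derive_entropy x : 0 < x < 1 ->
  is_derive x (1 : R) (@entropy R) (ln (1 - x) - ln x).
Proof.
move=> /andP[x0 x1].
have d1 := is_derive1_ln x0.
have d2 := is_derive_ln_onem x1; have d3 := is_derive_onem x.
have -> : @entropy R = (- ((@id R) * (@ln R))) -
    ((fun z : R => 1 - z) * (fun z : R => ln (1 - z))).
  by apply/funext => z; rewrite /entropy !fctE /= mulNr.
apply: is_derive_eq; rewrite /GRing.scale/=; field.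
by rewrite subr_eq0 !gt_eqF.
Qed.

End entropy_facts.

(** * Convexity of H (x y) / x as a function of H x / x *)

Section supporting_line.
Context {R : realType}.
Implicit Types x y b : R.

(** Dividing by x is what makes the terms in ln (x y) cancel, leaving a single logarithm. *)
Lemma is_derive_entropy_slope x y : 0 < x < 1 -> 0 < y <= 1 ->
  is_derive x (1 : R) (fun z : R => entropy (z * y) / z)
    (ln (1 - x * y) / x ^+ 2).
Proof.
move=> /andP[x0 x1] /andP[y0 y1].
have xy0 : 0 < x * y by rewrite mulr_gt0.
have xy1 : x * y < 1 by nra.
have xy01 : 0 < x * y < 1 by rewrite xy0 xy1.
have d1 := is_derive_entropy xy01.
have d2 : is_derive x (1 : R) (fun z : R => z * y) y.
  have -> : (fun z : R => z * y) = (@id R) * cst y by [].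
  by apply: is_derive_eq; rewrite /GRing.scale/= mulr0 add0r mulr1.
have d3 : is_derive x (1 : R) (fun z : R => entropy (z * y))
    ((ln (1 - x * y) - ln (x * y)) * y).
  exact: (@is_derive1_comp _ (@entropy R) (fun z : R => z * y)).
have d4 : is_derive x (1 : R) (fun z : R => z^-1) (- x ^- 2).
  have xn : (@id R) x != 0 by rewrite gt_eqF.
  have := @is_deriveV R (@id R) x 1 1 xn (is_derive_id x 1).
  by rewrite /GRing.scale/= mulr1.
have -> : (fun z : R => entropy (z * y) / z) =
  (fun z : R => entropy (z * y)) * (fun z : R => z^-1) by [].
apply: is_derive_eq.
rewrite /GRing.scale/= {1}/entropy.
by field; rewrite gt_eqF.
Qed.

Lemma continuous_entropy_slope y a : 0 < a ->
  {within `[a, 1], continuous (fun z : R => entropy (z * y) / z)}.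
Proof.
move=> a0; apply: continuous_in_subspaceT => x /set_mem /=.
rewrite in_itv/= => /andP[ax _].
have x0 : x != 0 by rewrite gt_eqF// (lt_le_trans a0).
apply: cvgM; last by apply: cvgV => //; exact: cvg_id.
apply: (@continuous_comp _ _ _ (fun z : R => z * y) (@entropy R)).
  by apply: cvgM; [exact: cvg_id|exact: cvg_cst].
exact: continuous_entropy.
Qed.

Lemma entropy_slope_min y b x0 x : 0 < y <= 1 -> 0 < x0 <= 1 ->
  (forall z : R, 0 < z < x0 -> ln (1 - z * y) <= b * ln (1 - z)) ->
  (forall z : R, x0 < z < 1 -> b * ln (1 - z) <= ln (1 - z * y)) ->
  0 < x <= 1 ->
  entropy (x0 * y) / x0 - b * (entropy x0 / x0) <=
  entropy (x * y) / x - b * (entropy x / x).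
Proof.
move=> y01 /andP[x00 x01] hl hr /andP[xp xle].
pose r := fun z : R => entropy (z * y) / z - b * (entropy z / z).
have rd (z : R) : 0 < z < 1 ->
    is_derive z (1 : R) r ((ln (1 - z * y) - b * ln (1 - z)) / z ^+ 2).
  move=> z01.
  have d1 := is_derive_entropy_slope z01 y01.
  (* The instance y = 1 of the derivative formula handles H z / z. *)
  have one1 : 0 < (1 : R) <= 1 by rewrite ltr01 lexx.
  have d2 := is_derive_entropy_slope z01 one1.
  have -> : r = (fun z : R => entropy (z * y) / z) -
      cst b * (fun z : R => entropy (z * 1) / z).
    by apply/funext => u; rewrite /r !fctE mulr1.
  by apply: is_derive_eq; rewrite /GRing.scale/= mulr0 addr0 mulr1 mulrBl mulrA.
have rc (a : R) : 0 < a -> {within `[a, 1], continuous r}.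
  move=> a0 z.
  have -> : r = (fun z : R => entropy (z * y) / z) -
      cst b * (fun z : R => entropy (z * 1) / z).
    by apply/funext => u; rewrite /r !fctE mulr1.
  apply: cvgB; first exact: continuous_entropy_slope.
  by apply: cvgM; [exact: cvg_cst|exact: continuous_entropy_slope].
rewrite -/(r x0) -/(r x).
have [xx0|xx0] := leP x x0.
- have rc' : {within `[x, x0], continuous r}.
    by apply: continuous_subspaceW (rc _ xp); apply/subset_itvl; rewrite bnd_simp.
  have inI (z : R) : z \in `]x, x0[ -> 0 < z < 1 /\ 0 < z < x0.
    rewrite in_itv/= => /andP[xz zx0].
    by rewrite (lt_trans xp xz) zx0 (lt_le_trans zx0 x01).
  apply: (ler0_derive1_le_cc _ _ rc') => //; rewrite ?in_itv/= ?lexx ?xx0//.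
  + by move=> z /inI[zI _]; exact: (@ex_derive _ _ _ _ _ _ _ (rd z zI)).
  + move=> z /inI[zI zI']; rewrite derive1E (@derive_val _ _ _ _ _ _ _ (rd z zI)).
    by rewrite mulr_le0_ge0 ?invr_ge0 ?sqr_ge0// subr_le0 hl.
- have rc' : {within `[x0, x], continuous r}.
    by apply: continuous_subspaceW (rc _ x00); apply/subset_itvl; rewrite bnd_simp.
  have inI (z : R) : z \in `]x0, x[ -> 0 < z < 1 /\ x0 < z < 1.
    rewrite in_itv/= => /andP[xz zx0].
    by rewrite (lt_trans x00 xz) xz (lt_le_trans zx0 xle).
  apply: (ger0_derive1_le_cc _ _ rc') => //; rewrite ?in_itv/= ?lexx ?(ltW xx0)//.
  + by move=> z /inI[zI _]; exact: (@ex_derive _ _ _ _ _ _ _ (rd z zI)).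
  + move=> z /inI[zI zI']; rewrite derive1E (@derive_val _ _ _ _ _ _ _ (rd z zI)).
    by rewrite mulr_ge0 ?invr_ge0 ?sqr_ge0// subr_ge0 hr.
Qed.

(** Bernoulli's inequality for t^l. With s the right-hand side, s is the mean of t and 1 with
    weights l and 1 - l. The tangent bounds ln u - ln s <= u / s - 1 at u = t and u = 1, taken with
    these weights, have right-hand sides that sum to 0. *)
Lemma expR_mul_ln_le (l t : R) : 0 <= l <= 1 -> 0 < t ->
  expR (l * ln t) <= 1 + l * (t - 1).
Proof.
move=> /andP[l0 l1] t0; set s := 1 + _.
have s0 : 0 < s.
  rewrite /s; have [->|ln0] := eqVneq l 1; first by rewrite mul1r addrC subrK.
  have : l < 1 by rewrite lt_neqAle ln0.
  by nra.
have key u : 0 < u -> ln u - ln s <= u / s - 1.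
  move=> u0; rewrite -ln_div ?posrE//.
  have := @le_ln1Dx _ (u / s - 1); rewrite [1 + _](_ : _ = u / s); last by ring.
  by apply; rewrite ltrBrDl subrr divr_gt0.
rewrite -[leRHS]lnK ?posrE// ler_expR.
have h1 := ler_wpM2l l0 (key _ t0).
have l1' : 0 <= 1 - l by rewrite subr_ge0.
have h2 := ler_wpM2l l1' (key _ ltr01).
have : l * (t / s - 1) + (1 - l) * (1 / s - 1) = 0.
  rewrite (_ : _ + _ = (1 + l * (t - 1)) / s - 1); last by field; rewrite gt_eqF.
  by rewrite -/s mulfV ?subrr// gt_eqF.
rewrite ln1 in h2; lra.
Qed.

(* In the variable [u = - ln (1 - x)], [- ln (1 - x * y)] is concave and
   vanishes at 0, so that [ln (1 - x * y) / ln (1 - x)] is nonincreasing. *)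
Lemma ln_onemM_ratio y x1 x2 : 0 <= y <= 1 -> 0 < x1 <= x2 -> x2 < 1 ->
  ln (1 - x1 * y) * - ln (1 - x2) <= - ln (1 - x1) * ln (1 - x2 * y).
Proof.
move=> /andP[y0 y1] /andP[x10 x12] x21.
have x11 := le_lt_trans x12 x21.
have X1 : 0 < 1 - x1 by rewrite subr_gt0.
have X2 : 0 < 1 - x2 by rewrite subr_gt0.
have v0 : 0 < - ln (1 - x2) by rewrite oppr_gt0 ln_lt0// X2 gtrBl (lt_le_trans x10).
have u0 : 0 < - ln (1 - x1) by rewrite oppr_gt0 ln_lt0// X1 gtrBl.
have uv : - ln (1 - x1) <= - ln (1 - x2) by rewrite lerN2 ler_ln ?posrE// lerB.
have Z0 : 0 < 1 - x2 * y by nra.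
have W0 : 0 < 1 - x1 * y by nra.
rewrite -ler_pdivlMr// mulrAC.
(* This exponent satisfies 1 - x1 = (1 - x2)^l, and the goal becomes 1 - x1 y <= (1 - x2 y)^l. *)
set l := _ / _.
have l01 : 0 <= l <= 1 
  by rewrite /l divr_ge0 ?(ltW u0) ?(ltW v0)//= ler_pdivrMr// mul1r.
have lX : expR (l * ln (1 - x2)) = 1 - x1.
  rewrite -[RHS]lnK ?posrE//; congr expR; rewrite /l; field.
  by move: v0; rewrite oppr_gt0 => /lt_eqF ->.
have h1 := expR_mul_ln_le l01 (divr_gt0 X2 Z0).
have h2 := expR_mul_ln_le l01 (divr_gt0 ltr01 Z0).
move: h1 h2; rewrite !ln_div ?posrE// ln1 sub0r mulrBr mulrN.
rewrite expRD lX expRN; set E := expR _ => h1 h2.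
have E0 : 0 < E by exact: expR_gt0.
rewrite -ler_expR lnK ?posrE// -/E.
(* The quotient is the mean, with weights y and 1 - y, of the l-th powers of (1 - x2) / (1 - x2 y)
   and 1 / (1 - x2 y). Bernoulli bounds each power, and the same weighted mean of the two bases is
   1. *)
suff : (1 - x1 * y) / E <= 1 by rewrite ler_pdivrMr// mul1r.
have y1' : 0 <= 1 - y by rewrite subr_ge0.
have h3 := ler_wpM2l y0 h1.
have h4 := ler_wpM2l y1' h2.
have : y * (1 + l * ((1 - x2) / (1 - x2 * y) - 1)) +
    (1 - y) * (1 + l * (1 / (1 - x2 * y) - 1)) = 1.
  by field; rewrite gt_eqF.
have -> : (1 - x1 * y) / E = y * ((1 - x1) / E) + (1 - y) * E^-1 by ring.
lra.
Qed.

(** In the coordinates H x / x and H (x y) / x this is a supporting line at x0 with slope b and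
    intercept a, multiplied by x so that x = 0 is included. *)
Lemma entropy_supporting_line y x0 : 0 <= y <= 1 -> 0 < x0 <= 1 ->
  exists a b, (forall x, 0 <= x <= 1 -> a * x + b * entropy x <= entropy (x * y))
    /\ entropy (x0 * y) = a * x0 + b * entropy x0.
Proof.
move=> /andP[y0 y1] /andP[x00 x01].
move: y0; rewrite le_eqVlt => /predU1P[<-|y0].
  exists 0, 0; rewrite mulr0 entropy0 !mul0r addr0; split=> // x _.
  by rewrite mulr0 entropy0 !mul0r addr0.
have [yI y0I] : 0 < y <= 1 /\ 0 <= y <= 1 by rewrite y0 y1 (ltW y0).
have x0I : 0 < x0 <= 1 by rewrite x00 x01.
suff [b hb] : exists b, forall x, 0 < x <= 1 ->
    entropy (x0 * y) / x0 - b * (entropy x0 / x0) <=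
    entropy (x * y) / x - b * (entropy x / x).
  exists (entropy (x0 * y) / x0 - b * (entropy x0 / x0)), b; split; last first.
    by field; rewrite gt_eqF.
  move=> x /andP[]; rewrite le_eqVlt => /predU1P[<- _|x0' x1].
    by rewrite mul0r entropy0 !mulr0 addr0.
  have := hb x; rewrite x0' x1 => /(_ isT) /(ler_wpM2r (ltW x0')).
  have -> : (entropy (x * y) / x - b * (entropy x / x)) * x =
      entropy (x * y) - b * entropy x by field; rewrite gt_eqF.
  lra.
have [x01'|x01'] := eqVneq x0 1.
  (* At x0 = 1 a horizontal line works: the condition on the left reads ln (1 - z y) <= 0, and the
     one on the right is vacuous. *)
  exists 0 => x xI; apply: entropy_slope_min => // z /andP[z0 z1].
    rewrite mul0r ln_le0// gerBl mulr_ge0// ltW//.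
  by rewrite mul0r x01' in z0 *; have := lt_trans z0 z1; rewrite ltxx.
have {x01'} x01' : x0 < 1 by rewrite lt_neqAle x01'.
have v0 : 0 < - ln (1 - x0).
  by rewrite oppr_gt0 ln_lt0// gtrBl x00 subr_gt0 x01'.
(* The slope is the ratio of the two derivatives at x0; monotonicity of this ratio gives the sign
   conditions on both sides. *)
exists (ln (1 - x0 * y) / ln (1 - x0)) => x xI.
have bE u : ln (1 - x0 * y) / ln (1 - x0) * ln (1 - u) =
   ln (1 - x0 * y) * - ln (1 - u) / - ln (1 - x0).
  by field; move: v0; rewrite oppr_gt0 => /lt_eqF ->.
apply: entropy_slope_min => // z /andP[z0 z1]; rewrite bE.
  rewrite ler_pdivlMr// [leRHS]mulrN -mulNr [leRHS]mulrC mulrN -mulNr.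
  have := @ln_onemM_ratio y z x0 y0I; rewrite z0 (ltW z1) => /(_ isT x01').
  lra.
rewrite ler_pdivrMr// [leRHS]mulrC.
by apply: ln_onemM_ratio => //; rewrite x00 ltW.
Qed.

End supporting_line.

(** * Truncated power series for H (x y), with a uniform error bound *)

Section entropy_expansion.
Context {R : realType}.
Implicit Types t x y : R.

(** The offset k serves two series: k = 0 for that of - ln (1 - t), k = 1 for that of its
    primitive. *)
Lemma is_derive_powers (c : R) t n k :
  is_derive t (1 : R) (fun z : R => c * z ^+ (n + k).+1)
    (c * (n + k).+1%:R * t ^+ (n + k)).
Proof.
have -> : (fun z : R => c * z ^+ (n + k).+1) = cst c * ((@id R) ^+ (n + k).+1).
  by apply/funext => z; rewrite !fctE.
apply: is_derive_eq; rewrite /GRing.scale/= mulr0 addr0 mulr1.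
by ring.
Qed.

Lemma is_derive_power_sum (c : nat -> R) t N k :
  is_derive t (1 : R) (fun z : R => \sum_(n < N) c n * z ^+ (n + k).+1)
    (\sum_(n < N) c n * (n + k).+1%:R * t ^+ (n + k)).
Proof.
have -> : (fun z : R => \sum_(n < N) c n * z ^+ (n + k).+1) =
    \sum_(n < N) (fun z : R => c n * z ^+ (n + k).+1).
  by apply/funext => z; rewrite fct_sumE.
apply: is_derive_sum => i; exact: is_derive_powers.
Qed.

Lemma continuous_power_sum (c : nat -> R) N k :
  continuous (fun z : R => \sum_(n < N) c n * z ^+ (n + k).+1).
Proof.
move=> z; apply: differentiable_continuous; apply/derivable1_diffP.
exact: (@ex_derive _ _ _ _ _ _ _ (is_derive_power_sum c z N k)).
Qed.

Lemma derive_ge0_ndecr (f df : R -> R) (a b : R) : a <= b ->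
  {within `[a, b], continuous f} ->
  (forall x, a < x < b -> is_derive x (1 : R) f (df x)) ->
  (forall x, a < x < b -> 0 <= df x) -> f a <= f b.
Proof.
move=> ab cf dff df0.
apply: (ger0_derive1_le_cc _ _ cf) => //; rewrite ?in_itv/= ?lexx ?ab//.
- move=> z; rewrite in_itv/= => zI; exact: (@ex_derive _ _ _ _ _ _ _ (dff z zI)).
- move=> z; rewrite in_itv/= => zI.
  by rewrite derive1E (@derive_val _ _ _ _ _ _ _ (dff z zI)) df0.
Qed.

(** The difference of the two sides vanishes at 0, and its derivative is 1 / (1 - t) minus a partial
    geometric sum, hence nonnegative. *)
Lemma ln_onem_le N t : 0 <= t < 1 ->
  ln (1 - t) <= - \sum_(n < N) t ^+ n.+1 / n.+1%:R.
Proof.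
move=> /andP[t0 t1].
pose f := fun z : R => - ln (1 - z) - \sum_(n < N) n.+1%:R^-1 * z ^+ (n + 0).+1.
pose df := fun z : R => (1 - z)^-1 - \sum_(n < N) z ^+ n.
have dff x : x < 1 -> is_derive x (1 : R) f (df x).
  move=> x1; have d1 := is_derive_ln_onem x1.
  have d2 := is_derive_power_sum (fun n => n.+1%:R^-1) x N 0.
  have -> : f = - (fun z : R => ln (1 - z)) -
      (fun z : R => \sum_(n < N) n.+1%:R^-1 * z ^+ (n + 0).+1) by [].
  apply: is_derive_eq; rewrite opprK /df; congr (_ - _).
  by apply: eq_bigr => i _; rewrite addn0 mulVf// mul1r.
have : f 0 <= f t.
  apply: (@derive_ge0_ndecr f df) => //.
  - apply: continuous_in_subspaceT => x /set_mem /=.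
    rewrite in_itv/= => /andP[_ xt].
    apply: differentiable_continuous; apply/derivable1_diffP.
    exact: (@ex_derive _ _ _ _ _ _ _ (dff x (le_lt_trans xt t1))).
  - by move=> x /andP[_ xt]; exact: dff (lt_trans xt t1).
  - move=> x /andP[x0 xt]; have x1 := lt_trans xt t1.
    have X0 : 0 < 1 - x by rewrite subr_gt0.
    rewrite /df subr_ge0 -[leRHS]mul1r ler_pdivlMr// mulrC -opprB mulNr -subrX1.
    by rewrite opprB gerBl exprn_ge0// ltW.
rewrite /f subr0 ln1 oppr0 big1 ?subr0; last first.
  by move=> i _; rewrite expr0n mulr0.
rewrite subr_ge0 lerNr => /le_trans; apply; rewrite lerN2.
by apply: ler_sum => i _; rewrite addn0 mulrC.
Qed.

(** A telescoping sum; it gives the truncation error at t = 1. *)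
Lemma sum_inv_pronic N :
  \sum_(n < N) (n.+1%:R * n.+2%:R)^-1 = 1 - N.+1%:R^-1 :> R.
Proof.
elim: N => [|N IH]; first by rewrite big_ord0 invr1 subrr.
rewrite big_ord_recr/= IH; field.
by rewrite !gt_eqF// ltr_pwDl.
Qed.

(** Partial sum of the power series of t + (1 - t) ln (1 - t). *)
Definition pronic_sum N t : R := \sum_(n < N) (n.+1%:R * n.+2%:R)^-1 * t ^+ n.+2.

(** The remainder f is nondecreasing on [0, 1], its derivative being the remainder of the series of
    - ln (1 - t). So f lies between f 0 = 0 and f 1 = 1 / (N + 1), which makes the error uniform in
    t. *)
Lemma xlnx_onem_approx N t : 0 <= t <= 1 ->
  pronic_sum N t <= t + (1 - t) * ln (1 - t) <= pronic_sum N t + N.+1%:R^-1.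
Proof.
move=> /andP[t0 t1].
pose S := fun z : R => \sum_(n < N) (n.+1%:R * n.+2%:R)^-1 * z ^+ (n + 1).+1.
have SE z : pronic_sum N z = S z by apply: eq_bigr => i _; rewrite addn1.
pose f := fun z : R => z + (1 - z) * ln (1 - z) - S z.
pose df := fun z : R => - ln (1 - z) - \sum_(n < N) z ^+ n.+1 / n.+1%:R.
have dff x : x < 1 -> is_derive x (1 : R) f (df x).
  move=> x1; have d1 := is_derive_ln_onem x1; have d0 := is_derive_onem x.
  have d2 := is_derive_power_sum (fun n => (n.+1%:R * n.+2%:R)^-1) x N 1.
  have -> : f = (@id R) + (fun z : R => 1 - z) * (fun z : R => ln (1 - z)) - S by [].
  apply: is_derive_eq; rewrite /GRing.scale/= /df; congr (_ - _).
    by field; rewrite subr_eq0 gt_eqF.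
  apply: eq_bigr => i _; rewrite addn1; field.
  by rewrite !gt_eqF// ltr_pwDl.
have cf : continuous f.
  move=> x; apply: cvgB; last first.
    exact: (@continuous_power_sum (fun n => (n.+1%:R * n.+2%:R)^-1) N 1 x).
  by apply: cvgD; [exact: cvg_id|exact: continuous_xlnx_onem].
have mono a b : 0 <= a -> a <= b -> b <= 1 -> f a <= f b.
  move=> a0 ab b1; apply: (@derive_ge0_ndecr f df) => //.
  - exact: continuous_subspaceT.
  - by move=> x /andP[_ xt]; exact: dff (lt_le_trans xt b1).
  - move=> x /andP[xa xt]; rewrite /df subr_ge0 lerNr; apply: ln_onem_le.
    by rewrite (le_trans a0 (ltW xa)) (lt_le_trans xt b1).
have f0 : f 0 = 0.
  rewrite /f subr0 ln1 mulr0 addr0 sub0r /S big1 ?oppr0// => i _.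
  by rewrite expr0n mulr0.
have f1 : f 1 = N.+1%:R^-1.
  rewrite /f subrr mul0r addr0 /S (eq_bigr (fun n : 'I_N => (n.+1%:R * n.+2%:R)^-1)).
    by rewrite sum_inv_pronic opprB addrC subrK.
  by move=> i _; rewrite expr1n mulr1.
have := mono 0 t (lexx _) t0 t1; have := mono t 1 t0 t1 (lexx _).
rewrite f0 f1 /f SE; move: (N.+1%:R^-1) => e h1 h2; apply/andP; split; lra.
Qed.

Lemma xlnxM x y : 0 <= x -> 0 <= y ->
  x * y * ln (x * y) = x * (y * ln y) + y * (x * ln x).
Proof.
rewrite le_eqVlt => /predU1P[<- _|x0]; first by rewrite !mul0r mulr0 addr0.
rewrite le_eqVlt => /predU1P[<-|y0]; first by rewrite !(mul0r, mulr0) addr0.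
by rewrite lnM ?posrE//; ring.
Qed.

(** The expansion of H (x y), cut after N powers. The power terms enter with a minus sign, so
    truncation overestimates H (x y). The uniform error lets finite sums be integrated, with no
    exchange of series and integral. *)
Definition entropy_approx N x y : R :=
  - (x * (y * ln y)) - y * (x * ln x) + x * y - pronic_sum N (x * y).

Lemma entropyM_approx N x y : 0 <= x <= 1 -> 0 <= y <= 1 ->
  entropy_approx N x y - N.+1%:R^-1 <= entropy (x * y) <= entropy_approx N x y.
Proof.
move=> /andP[x0 x1] /andP[y0 y1].
have xy : 0 <= x * y <= 1 by rewrite mulr_ge0//= mulr_ile1.
have := xlnx_onem_approx N xy; have := xlnxM x0 y0.
rewrite /entropy_approx /entropy; move: (N.+1%:R^-1) => e h /andP[h1 h2].
by apply/andP; split; lra.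
Qed.

End entropy_expansion.

(** * Expectations under a law on [0, 1] as real integrals over [0, 1] *)

Section unit_interval_distribution.
Context {R : realType}.
Local Notation T := (measurableTypeR R).
Variable P : probability T R.
Hypothesis PI : on_unit_interval P.
Local Notation I := (`[0, 1]%classic : set T).
Implicit Types f : T -> R.

Let mI : measurable I. Proof. exact: measurable_itv. Qed.

Let PCI : P (~` I) = 0%E.
Proof. by rewrite probability_setC// PI subee. Qed.

(** A bound on [0, 1] is enough because the complement is negligible; [entropy] itself is unbounded
    on the real line. *)
Lemma integrable_unit f : measurable_fun setT f ->
  (exists M : R, forall x, 0 <= x <= 1 -> `|f x| <= M) ->
  P.-integrable setT (EFin \o f).
Proof.
move=> mf [M fM].
move/measurable_EFinP: (mf) => mf'.
apply/(negligible_integrable (measurableC mI) measurableT mf' PCI).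
rewrite setTD setCK; apply: measurable_bounded_integrable => //.
- by apply: (le_lt_trans _ (ltry 1)); exact: probability_le1.
- exact: measurable_funS mf.
exists M; split; first exact: num_real.
by move=> u Mu x /=; rewrite in_itv/= => /fM/le_trans; apply; exact: ltW.
Qed.

Lemma integrableS_unit f : P.-integrable setT (EFin \o f) ->
  P.-integrable I (EFin \o f).
Proof. exact: integrableS. Qed.

Lemma continuous_integrable_unit (f : R -> R) : continuous f ->
  P.-integrable setT (EFin \o (f : T -> R)).
Proof.
move=> cf; apply: integrable_unit; first exact: continuous_measurable_fun.
have /compact_bounded[M [_ fM]] : compact (f @` I).
  by apply: continuous_compact; [exact: continuous_subspaceT|exact: segment_compact].
exists (M + 1) => x xI; apply: (fM (M + 1)); first by rewrite ltrDl.
by exists x => //=; rewrite in_itv.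
Qed.

Lemma expectation_unit f : P.-integrable setT (EFin \o f) ->
  'E_P[f]%E = (\int[P]_(x in I) f x)%:E.
Proof.
move=> intf; rewrite unlock (negligible_integral (N := ~` I))//; last first.
  exact: measurableC.
rewrite setTD setCK /Rintegral fineK//.
by apply: integrable_fin_num => //; exact: integrableS_unit.
Qed.

Let J y := \int[P]_(x in I) entropy (y * x).

Let entropy_bounded : exists M : R, forall x, 0 <= x <= 1 -> `|entropy x| <= M.
Proof.
have /compact_bounded[M [_ fM]] : compact (@entropy R @` I).
  apply: continuous_compact; last exact: segment_compact.
  exact/continuous_subspaceT/continuous_entropy.
exists (M + 1) => x xI; apply: (fM (M + 1)); first by rewrite ltrDl.
by exists x => //=; rewrite in_itv.
Qed.

Let integrable_prod : (P \x P)%E.-integrable setT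
  (fun z : T * T => (entropy (z.1 * z.2))%:E).
Proof.
have mf : measurable_fun [set: T * T] (fun z : T * T => entropy (z.1 * z.2)).
  apply: (@measurableT_comp _ _ _ _ _ _ (@entropy R)).
    by apply: continuous_measurable_fun; exact: continuous_entropy.
  by apply: measurable_funM; [exact: measurable_fst|exact: measurable_snd].
have mII : measurable (I `*` I : set (T * T)) by exact: measurableX.
have PII : ((P \x P) (I `*` I) = 1)%E.
  rewrite product_measure1E// -[RHS]mule1; congr (_ * _)%E; exact: PI.
have PCII : ((P \x P) (~` (I `*` I)) = 0)%E.
  rewrite probability_setC//; transitivity (1 - 1 : \bar R)%E; last by rewrite subee.
  by congr (1 - _)%E; exact: PII.
move/measurable_EFinP: (mf) => mf'.
apply/(negligible_integrable (measurableC mII) measurableT mf' PCII).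
rewrite setTD setCK.
apply: (@measurable_bounded_integrable _ _ _ _
  (fun z : T * T => entropy (z.1 * z.2))) => //.
- by apply: (le_lt_trans _ (ltry 1)); exact: probability_le1.
- exact: measurable_funS mf.
have [M hM] := entropy_bounded.
exists M; split; first exact: num_real.
move=> u Mu [x y] /= []; rewrite !in_itv/= => /andP[x0 x1] /andP[y0 y1].
apply: le_trans (ltW Mu); apply: hM.
by rewrite mulr_ge0//= mulr_ile1.
Qed.

(** Proved for every real y, because the inner integral in Fubini's theorem is a function on the
    whole line. *)
Let JE y : (\int[P]_x (entropy (y * x))%:E)%E = (J y)%:E.
Proof.
have ci := continuous_integrable_unit (continuous_entropyM (y := y)).
rewrite -(expectation_unit ci).
by rewrite unlock.
Qed.

Lemma integrable_entropy_slice : P.-integrable setT (EFin \o J).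
Proof.
have := integrable_fubini_F integrable_prod.
by congr (integrable _ _ _); apply/funext => y; exact: JE.
Qed.

Lemma expectation_entropy_prod :
  'E_(P \x P)[fun z : R * R => entropy (z.1 * z.2)]%E =
  (\int[P]_(y in I) J y)%:E.
Proof.
rewrite unlock -(integral12_prod_meas1 integrable_prod).
rewrite -(expectation_unit integrable_entropy_slice) unlock.
by apply: eq_integral => y _; exact: JE.
Qed.

End unit_interval_distribution.

(** * The law with mass w at x and 1 - w at 0 *)

Section two_point_distribution.
Context {R : realType}.
Local Notation T := (measurableTypeR R).
Implicit Types w x : R.

Definition scaled_bool x (b : bool) : T := if b then x else 0.

Lemma measurable_scaled_bool x : measurable_fun setT (scaled_bool x).
Proof. by []. Qed.

HB.instance Definition _ x :=
  isMeasurableFun.Build _ _ _ _ (scaled_bool x) (measurable_scaled_bool x).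

(** As the image of a Bernoulli law this is a probability for every real w; the bounds on w enter
    only when integrals are computed. *)
Definition two_point w x : probability T R :=
  distribution (bernoulli_prob w) (scaled_bool x).

Lemma two_point_unit w x : 0 <= x <= 1 -> on_unit_interval (two_point w x).
Proof.
move=> xI; rewrite /on_unit_interval /two_point /distribution /pushforward/=.
rewrite (_ : _ @^-1` _ = setT) ?probability_setT//.
by apply/seteqP; split=> // -[] _ /=; rewrite in_itv//= lexx ler01.
Qed.

(** The complement of {0, x} is open and its preimage under [scaled_bool x] is empty, so it is a
    null neighbourhood of any other point. *)
Lemma msupport_two_point w x z : msupport (two_point w x) z -> z != 0 -> z = x.
Proof.
move=> zq z0; apply/eqP; apply/negPn/negP => zx.
have oU : open (~` [set 0] `&` ~` [set x] : set R).
  by apply: openI; apply: closed_openC; 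
    exact/accessible_closed_set1/hausdorff_accessible/Rhausdorff.
have Uz : (~` [set 0] `&` ~` [set x]) z by split => /=; exact/eqP.
have := zq _ oU Uz; rewrite /two_point /distribution /pushforward/=.
rewrite (_ : _ @^-1` _ = set0) ?measure0 ?ltxx//.
by apply/seteqP; split=> // -[] [h1 h2]; [exact: (h2 erefl)|exact: (h1 erefl)].
Qed.

Lemma Rintegral_two_point w x (f : T -> R) : 0 <= w <= 1 -> 0 <= x <= 1 ->
  measurable_fun setT f -> (forall z, 0 <= z <= 1 -> 0 <= f z) ->
  \int[two_point w x]_(z in `[0, 1]) f z = w * f x + (1 - w) * f 0.
Proof.
move=> w01 xI mf f0; rewrite /Rintegral /two_point /distribution.
have pre : scaled_bool x @^-1` `[0, 1] = setT.
  by apply/seteqP; split=> // -[] _ /=; rewrite in_itv//= lexx ler01.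
have fb b : 0 <= f (scaled_bool x b) by apply: f0; case: b => //=; rewrite lexx ler01.
rewrite ge0_integral_pushforward//.
- by rewrite pre integral_bernoulli_prob//= => b; rewrite lee_fin.
- by apply: measurable_funS (_ : measurable_fun setT _) => //; exact/measurable_EFinP.
- by move=> z /set_mem/=; rewrite in_itv/= lee_fin => /f0.
Qed.

End two_point_distribution.

(** * Moments of p and negativity of the kernel H (x y) on differences of laws with equal mean *)

Section moments.
Context {R : realType}.
Local Notation T := (measurableTypeR R).
Variable P : probability T R.
Hypothesis PI : on_unit_interval P.
Local Notation I := (`[0, 1]%classic : set T).
Local Notation J := (fun y : R => \int[P]_(x in I) entropy (y * x)).
Local Notation m := (\int[P]_(x in I) x).
Local Notation c := (\int[P]_(x in I) (x * ln x)).
Local Notation mu n := (\int[P]_(x in I) x ^+ n.+2).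

Let mI : measurable I. Proof. exact: measurable_itv. Qed.

Let ci (f : R -> R) : continuous f -> P.-integrable I (EFin \o (f : T -> R)).
Proof. by move=> cf; apply: integrableS_unit; exact: continuous_integrable_unit. Qed.

Lemma RintegralD_unit (f g : R -> R) : continuous f -> continuous g ->
  \int[P]_(x in I) (f x + g x) = \int[P]_(x in I) f x + \int[P]_(x in I) g x.
Proof. by move=> cf cg; rewrite RintegralD//; exact: ci. Qed.

Lemma RintegralZl_unit (f : R -> R) (a : R) : continuous f ->
  \int[P]_(x in I) (a * f x) = a * \int[P]_(x in I) f x.
Proof. by move=> cf; rewrite RintegralZl//; exact: ci. Qed.

Lemma Rintegral_cst_unit (a : R) : \int[P]_(x in I) a = a.
Proof. by rewrite Rintegral_cst// [X in fine X](PI : _ = 1%E) mulr1. Qed.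

Lemma le_Rintegral_unit (f g : R -> R) : continuous f -> continuous g ->
  (forall x, 0 <= x <= 1 -> f x <= g x) ->
  \int[P]_(x in I) f x <= \int[P]_(x in I) g x.
Proof.
move=> cf cg fg; apply: le_Rintegral; [exact: mI|exact: ci|exact: ci|].
by move=> x /=; rewrite in_itv/= => /fg.
Qed.

Let cM (a : R) (f : R -> R) : continuous f -> continuous (fun x => a * f x).
Proof. by move=> cf x; apply: cvgM; first exact: cvg_cst; exact: cf. Qed.

Let cD (f g : R -> R) : continuous f -> continuous g -> continuous (fun x => f x + g x).
Proof. by move=> cf cg x; apply: cvgD; first exact: cf; exact: cg. Qed.

Let cX : continuous (fun x : R => x). Proof. by move=> x; exact: cvg_id. Qed.

Let cc (a : R) : continuous (fun _ : R => a). Proof. by move=> x; exact: cvg_cst. Qed.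

Let cXn n : continuous (fun x : R => x ^+ n).
Proof. by move=> x; exact: exprn_continuous. Qed.

Let cS N (d : nat -> R) : continuous (fun x : R => \sum_(n < N) d n * x ^+ n.+2).
Proof.
elim: N => [|N IH].
  have -> : (fun x : R => \sum_(n < 0) d n * x ^+ n.+2) = cst 0; last exact: cc.
  by apply/funext => x; rewrite big_ord0.
rewrite (_ : (fun x : R => \sum_(n < N.+1) d n * x ^+ n.+2) =
  (fun x => \sum_(n < N) d n * x ^+ n.+2 + d N * x ^+ N.+2)).
  by apply: cD => //; exact: cM.
by apply/funext => x; rewrite big_ord_recr.
Qed.

Lemma Rintegral_sum_unit N (d : nat -> R) :
  \int[P]_(x in I) (\sum_(n < N) d n * x ^+ n.+2) = \sum_(n < N) d n * mu n.
Proof.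
elim: N => [|N IH].
  under eq_Rintegral do rewrite big_ord0.
  by rewrite Rintegral_cst_unit big_ord0.
under eq_Rintegral do rewrite big_ord_recr/=.
rewrite RintegralD_unit ?RintegralZl_unit// ?IH ?big_ord_recr//.
all: by [exact: cXn|exact: cS|apply: cM; exact: cXn].
Qed.

(** The span of x ln x, x and higher powers contains every slice of [entropy_approx], and still
    contains the kernel after one variable is integrated out. *)
Let combination N (a b : R) (d : nat -> R) x :=
  a * (x * ln x) + b * x + \sum_(n < N) d n * x ^+ n.+2.

Let continuous_combination N a b d : continuous (combination N a b d).
Proof.
by do 2 apply: cD => //; apply: cM => //; exact: continuous_xlnx.
Qed.

Let Rintegral_combination N a b d :
  \int[P]_(x in I) combination N a b d x = a * c + b * m + \sum_(n < N) d n * mu n.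
Proof.
have cx := @continuous_xlnx R.
rewrite RintegralD_unit//; last by apply: cD => //; exact: cM.
rewrite RintegralD_unit ?Rintegral_sum_unit ?RintegralZl_unit//; exact: cM.
Qed.

Let continuous_slice := @continuous_entropyM R.

Let k n : R := (n.+1%:R * n.+2%:R)^-1.

Let entropy_approxE N x y :
  entropy_approx N x y =
  combination N (- x) (x - x * ln x) (fun n => - (k n * x ^+ n.+2)) y.
Proof.
rewrite /entropy_approx /pronic_sum /combination -sumrN.
congr (_ + _); first by ring.
by apply: eq_bigr => i _; rewrite exprMn /k; ring.
Qed.

(** The truncated counterpart of [J]: the approximate kernel with its second variable integrated
    out, so that the coefficients are moments. *)
Let V N x := combination N (- m) (m - c) (fun n => - (k n * mu n)) x.

Let Rintegral_approx N x : \int[P]_(y in I) entropy_approx N x y = V N x.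
Proof.
under eq_Rintegral do rewrite entropy_approxE.
rewrite Rintegral_combination /V /combination; congr (_ + _); first by ring.
by apply: eq_bigr => i _; ring.
Qed.

Let cA N (x : R) : continuous (entropy_approx N x).
Proof.
rewrite (_ : @entropy_approx R N x =
  combination N (- x) (x - x * ln x) (fun n => - (k n * x ^+ n.+2))).
  exact: continuous_combination.
by apply/funext => y; exact: entropy_approxE.
Qed.

Let slice_le N x : 0 <= x <= 1 ->
  V N x - N.+1%:R^-1 <= J x <= V N x.
Proof.
move=> xI; rewrite -Rintegral_approx; apply/andP; split.
  rewrite -[X in _ - X <= _]Rintegral_cst_unit -mulN1r -RintegralZl_unit//.
  rewrite -RintegralD_unit//.
  apply: le_Rintegral_unit => //; first exact: cD.
  by move=> y yI; have /andP[+ _] := entropyM_approx N xI yI; rewrite mulN1r.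
by apply: le_Rintegral_unit => // y yI; have /andP[_] := entropyM_approx N xI yI.
Qed.

(** Integrating [V] once more turns each power term into the square of a moment. No error term
    appears, since [V] bounds [J] from above. *)
Let mean_slice_le N : \int[P]_(x in I) J x <=
  - 2 * (m * c) + m ^+ 2 - \sum_(n < N) k n * mu n ^+ 2.
Proof.
apply: (@le_trans _ _ (\int[P]_(x in I) V N x)).
  apply: le_Rintegral; [exact: mI| |exact/ci/continuous_combination|].
    by apply: integrableS_unit; exact: integrable_entropy_slice.
  by move=> x /=; rewrite in_itv/= => /(slice_le N)/andP[].
rewrite Rintegral_combination -sumrN le_eqVlt; apply/orP; left; apply/eqP.
congr (_ + _); first by ring.
by apply: eq_bigr => i _; ring.
Qed.

(* After subtracting the terms that are bilinear in [E X] and [E (X ln X)],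
   the two sides differ by [\sum_n k n * (mu n - w * x0 ^+ n.+2) ^+ 2]. *)
Lemma entropy_kernel_concave w x0 : 0 <= w <= 1 -> 0 <= x0 <= 1 -> w * x0 = m ->
  w ^+ 2 * entropy (x0 * x0) + \int[P]_(x in I) J x <= 2 * (w * J x0).
Proof.
move=> /andP[w0 w1] xI wm; apply/ler_addgt0Pr => e e0.
have e2 : 0 < e / 2 by rewrite divr_gt0.
(* Only the lower bound on [J x0] carries an error; it is multiplied by 2 w with w <= 1, hence the
   target e / 2. *)
have [N Ne] : exists N, N.+1%:R^-1 < e / 2.
  have := archi_boundP (ltW (_ : 0 < (e / 2)^-1)); rewrite invr_gt0 => /(_ e2) bd.
  exists (Num.bound (e / 2)^-1); rewrite -[ltRHS]invrK ltf_pV2 ?posrE ?invr_gt0//.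
  by rewrite (lt_trans bd)// ltr_nat.
have /andP[J1 _] := slice_le N xI.
have /andP[_ H1] := entropyM_approx N xI xI.
have F1 := mean_slice_le N.
have sq : 0 <= \sum_(n < N) k n * (mu n - w * x0 ^+ n.+2) ^+ 2.
  by apply: sumr_ge0 => i _; rewrite mulr_ge0 ?sqr_ge0// invr_ge0 mulr_ge0.
have sqE : \sum_(n < N) k n * (mu n - w * x0 ^+ n.+2) ^+ 2 =
    \sum_(n < N) k n * mu n ^+ 2
    + 2 * (w * \sum_(n < N) - (k n * mu n) * x0 ^+ n.+2)
    + w ^+ 2 * pronic_sum N (x0 * x0).
  rewrite /pronic_sum !mulr_sumr -!big_split/=; apply: eq_bigr => i _.
  by rewrite exprMn /k; ring.
have w2 : 0 <= w ^+ 2 by exact: sqr_ge0.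
have H2 := ler_wpM2l w2 H1.
have J2 := ler_wpM2l w0 J1.
have we : w * N.+1%:R^-1 <= e / 2.
  by rewrite (le_trans _ (ltW Ne))// ler_piMl// invr_ge0.
move: sq F1 H2 J2; rewrite sqE /V /combination /entropy_approx.
set S1 := \sum_(n < N) _; set S2 := \sum_(n < N) _; set S3 := pronic_sum _ _.
(* With m = w x0 the terms containing x0 ln x0, c or m^2 cancel between the two sides. *)
rewrite -wm.
move: we; set E1 := w * _^-1 => we.
rewrite [w * (_ - N.+1%:R^-1)]mulrBr -/E1.
move: E1 we => E1 we.
nra.
Qed.

End moments.

(** * A two-point law with the same mean and mean entropy *)

Section matching.
Context {R : realType}.
Local Notation T := (measurableTypeR R).
Variable P : probability T R.
Hypothesis PI : on_unit_interval P.
Local Notation I := (`[0, 1]%classic : set T).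
Local Notation m := (\int[P]_(x in I) x).
Local Notation h := (\int[P]_(x in I) entropy x).

Let continuous_affine (a b : R) : continuous (fun x : R => a * x + b).
Proof.
move=> x; apply: cvgD; last exact: cvg_cst.
by apply: cvgM; [exact: cvg_cst|exact: cvg_id].
Qed.

Let continuous_idR : continuous (fun x : R => x).
Proof. by move=> x; exact: cvg_id. Qed.

Lemma mean_unit : 0 <= m <= 1.
Proof.
apply/andP; split.
  by apply: Rintegral_ge0 => x /=; rewrite in_itv/= => /andP[].
rewrite -[leRHS](Rintegral_cst_unit PI); apply: le_Rintegral_unit => //.
  by move=> x; exact: cvg_cst.
by move=> x /andP[].
Qed.

Lemma mean_entropy_ge0 : 0 <= h.
Proof. by apply: Rintegral_ge0 => x /=; rewrite in_itv/= => /entropy_ge0. Qed.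

Lemma mean_entropy_gibbs t : 0 < t < 1 ->
  h <= - (m * ln t) - (1 - m) * ln (1 - t).
Proof.
move=> tI; set a := ln (1 - t) - ln t; set b := - ln (1 - t).
apply: (@le_trans _ _ (\int[P]_(x in I) (a * x + b))).
  apply: le_Rintegral_unit => //; first exact: continuous_entropy.
  by move=> x xI; apply: (le_trans (entropy_gibbs xI tI)); rewrite /a /b; lra.
rewrite RintegralD_unit//; last 2 first.
- by move=> x; apply: cvgM; [exact: cvg_cst|exact: cvg_id].
- by move=> x; exact: cvg_cst.
rewrite RintegralZl_unit// Rintegral_cst_unit// /a /b; lra.
Qed.

(* The Gibbs bound at t = m is Jensen's inequality; for m = 0 or m = 1 one lets
   t tend to m instead. *)
Lemma mean_entropy_le : h <= entropy m.
Proof.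
have := mean_unit => /andP[]; rewrite le_eqVlt => /predU1P[m0 _|m0].
  rewrite -m0 entropy0; apply/ler_addgt0Pr => e e0; rewrite add0r.
  (* For m = 0 the Gibbs bound is - ln (1 - t), which equals e at this t. *)
  have := @mean_entropy_gibbs (1 - expR (- e)).
  rewrite (_ : 1 - (1 - _) = expR (- e)); last by ring.
  rewrite -m0 mul0r oppr0 sub0r addr0 mul1r expRK opprK; apply.
  by rewrite subr_gt0 gtrBl expR_gt0 expR_lt1 oppr_lt0 e0.
rewrite le_eqVlt => /predU1P[m1|m1].
  rewrite m1 entropy1; apply/ler_addgt0Pr => e e0; rewrite add0r.
  have := @mean_entropy_gibbs (expR (- e)).
  rewrite m1 subrr mul0r subr0 mul1r expRK opprK; apply.
  by rewrite expR_gt0 expR_lt1 oppr_lt0 e0.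
by rewrite /entropy mulNr; apply: mean_entropy_gibbs; rewrite m0.
Qed.

(** Eliminating w = m / x0 leaves the equation m H(x0) = h x0. The difference of its sides is m
    (H(m) - h) >= 0 at m and - h <= 0 at 1, so the intermediate value theorem gives a root; x0 >= m
    then ensures w <= 1. *)
Lemma two_point_matching : exists w x0 : R,
  [/\ 0 <= w <= 1, 0 < x0 <= 1, w * x0 = m & w * entropy x0 = h].
Proof.
have /andP[m0 m1] := mean_unit.
have hle := mean_entropy_le; have h0 := mean_entropy_ge0.
move: m0; rewrite le_eqVlt => /predU1P[m0|m0].
  (* If m = 0 then h = 0 too, and weight 0 on any admissible point will do. *)
  exists 0, 1; rewrite !lexx ler01 ltr01 !mul0r; split=> //.
  by apply: le_anti; rewrite h0 /= (le_trans hle)// -m0 entropy0.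
pose f x := m * entropy x - h * x.
have fc : continuous f.
  move=> x; apply: cvgB; apply: cvgM; try exact: cvg_cst.
    exact: continuous_entropy.
  exact: cvg_id.
have fm : 0 <= f m.
  by rewrite /f -mulrC -mulrBl mulr_ge0 ?subr_ge0// ltW.
have f1 : f 1 <= 0 by rewrite /f entropy1 mulr0 sub0r mulr1 oppr_le0.
have [||x0] := @IVT R f m 1 0 m1; first exact: continuous_subspaceT.
  by rewrite ge_min f1 orbT le_max fm.
rewrite in_itv/= => /andP[mx x1] fx.
have x00 : 0 < x0 by exact: lt_le_trans mx.
exists (m / x0), x0; split.
- by rewrite divr_ge0 ?(ltW m0) ?(ltW x00)//= ler_pdivrMr// mul1r.
- by rewrite x00.
- by rewrite divfK// gt_eqF.
- rewrite mulrAC; move/eqP: fx; rewrite subr_eq0 => /eqP ->.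
  by rewrite mulfK// gt_eqF.
Qed.

(** Jensen's inequality in integrated form: the integral of the supporting line at x0 depends only
    on m and h, so it agrees with its value under the two-point law, where the line touches the
    curve. No division by m occurs. *)
Lemma entropy_slice_ge w x0 y : 0 < x0 <= 1 ->
  w * x0 = m -> w * entropy x0 = h -> 0 <= y <= 1 ->
  w * entropy (x0 * y) <= \int[P]_(x in I) entropy (y * x).
Proof.
move=> x0I wm wh yI; have [a [b [le_ab ->]]] := entropy_supporting_line yI x0I.
have -> : w * (a * x0 + b * entropy x0) = \int[P]_(x in I) (a * x + b * entropy x).
  rewrite RintegralD_unit// ?RintegralZl_unit//.
  - by rewrite -wm -wh; ring.
  - exact: continuous_entropy.
  - by move=> x; apply: cvgM; [exact: cvg_cst|exact: cvg_id].
  - by move=> x; apply: cvgM; [exact: cvg_cst|exact: continuous_entropy].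
apply: le_Rintegral_unit => //.
- move=> x; apply: cvgD; apply: cvgM; try exact: cvg_cst.
    exact: cvg_id.
  exact: continuous_entropy.
- exact: continuous_entropyM.
- by move=> x /le_ab; rewrite (mulrC x).
Qed.

End matching.

(** * Conclusion: comparing the two-point law with p *)

Theorem theorem3 (R : realType) (p : probability (measurableTypeR R) R)
    (hp : on_unit_interval p) :
  exists q : probability (measurableTypeR R) R,
    [/\ on_unit_interval q,
        forall x y : R, msupport q x -> msupport q y ->
          x != 0 -> y != 0 -> x = y,
        ('E_q[fun x : R => x] = 'E_p[fun x : R => x])%E,
        ('E_q[@entropy R] = 'E_p[@entropy R])%E &
        ('E_(q \x q)[fun z : R * R => entropy (z.1 * z.2)]
          <= 'E_(p \x p)[fun z : R * R => entropy (z.1 * z.2)])%E].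
Proof.
have [w [x0 [wI x0I wm wh]]] := two_point_matching hp.
have x0I' : 0 <= x0 <= 1 by case/andP: x0I => /ltW -> ->.
have qI := two_point_unit w x0I'.
have cid : continuous (fun x : R => x) by move=> x; exact: cvg_id.
have cslice := @continuous_entropyM R.
have mulI (y z : R) : 0 <= y <= 1 -> 0 <= z <= 1 -> 0 <= y * z <= 1.
  by move=> /andP[y0 y1] /andP[z0 z1]; rewrite mulr_ge0//= mulr_ile1.
exists (two_point w x0); split => //.
- move=> x y qx qy x_neq0 y_neq0.
  by rewrite (msupport_two_point qx x_neq0) (msupport_two_point qy y_neq0).
- rewrite !expectation_unit//; try exact: continuous_integrable_unit.
  congr EFin; rewrite Rintegral_two_point// ?mulr0 ?addr0//.
  by move=> z /andP[].
- have ce := @continuous_entropy R.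
  rewrite !expectation_unit//; try exact: continuous_integrable_unit.
  congr EFin; rewrite Rintegral_two_point// ?entropy0 ?mulr0 ?addr0//.
  + exact: continuous_measurable_fun.
  + exact: entropy_ge0.
rewrite !expectation_entropy_prod// lee_fin.
(* The atom at 0 contributes nothing because H(0) = 0. *)
have qslice y : 0 <= y <= 1 ->
    \int[two_point w x0]_(x in `[0, 1]) entropy (y * x) = w * entropy (y * x0).
  move=> yI; rewrite Rintegral_two_point// ?mulr0 ?entropy0 ?mulr0 ?addr0//.
  + by apply: continuous_measurable_fun; exact: cslice.
  + by move=> z zI; apply/entropy_ge0/mulI.
rewrite Rintegral_two_point//; last 2 first.
- by have /measurable_int/measurable_EFinP := integrable_entropy_slice qI.
- by move=> y yI; rewrite qslice// mulr_ge0 ?entropy_ge0 ?mulI//; case/andP: wI.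
have I0 : 0 <= (0 : R) <= 1 by rewrite lexx ler01.
rewrite !qslice// mul0r entropy0 !mulr0 addr0 mulrA -expr2.
(* In the notation of the overview this is B (q, q) + B (p, p) <= 2 B (p, q), with B (p, q) = w
   [J x0]; the next inequality is B (p, q) <= B (p, p), obtained by integrating the slice bound over
   y. *)
have := entropy_kernel_concave hp wI x0I' wm.
have : w * \int[p]_(y in `[0, 1]) entropy (x0 * y) <=
    \int[p]_(y in `[0, 1]) \int[p]_(x in `[0, 1]) entropy (y * x).
  rewrite -(RintegralZl_unit hp w (cslice x0)).
  apply: le_Rintegral => //.
  + apply: integrableS_unit; apply: continuous_integrable_unit => //.
    by move=> x; apply: cvgM; [exact: cvg_cst|exact: cslice].
  + by apply: integrableS_unit; exact: integrable_entropy_slice.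
  + by move=> y /=; rewrite in_itv/=; exact: entropy_slice_ge.
lra.
Qed.
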